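(* Let $n\ge3$ be an integer, let $J$ be an interval with left endpoint $0\in J$, let $\mathcal{T}:J\to\mathbb{R}^{2\times2}$ be symmetric-matrix valued and of class $C^k$ with $k\ge 2n$, and let $\mathcal{D}$ solve $\ddot{\mathcal{D}}=\mathcal{T}\mathcal{D}$, $\mathcal{D}(0)=0$, $\dot{\mathcal{D}}(0)=I$. If the first non-vanishing term in the Taylor expansion of the shear $\Gamma(\epsilon)$ of $\mathcal{D}(\epsilon)$ at the vertex $\epsilon=0$ is of order $\epsilon^n$, then the leading term of the twist $\omega(\epsilon)$ of $\mathcal{D}(\epsilon)$ at the vertex is at least of order $\epsilon^{2n}$, i.e. all Taylor coefficients of $\omega$ at $0$ of order less than $2n$ vanish.
   Context: For $\mathcal{D}=(d_{ij})$ a real $2\times2$ matrix, its twist is $\omega=\frac12(d_{12}-d_{21})\in\mathbb{R}$ and its shear is $\Gamma=\frac12(d_{11}-d_{22})+\frac{i}{2}(d_{12}+d_{21})\in\mathbb{C}$. Dots denote derivatives with respect to the parameter $\lambda=\epsilon$. *)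

(* Defs.v *)
From HB Require Import structures.
From mathcomp Require Import all_boot all_order all_algebra.
From mathcomp Require Import all_classical all_reals all_analysis.
From mathcomp Require Import complex.

Set Implicit Arguments.
Unset Strict Implicit.
Unset Printing Implicit Defensive.

Import Order.TTheory GRing.Theory Num.Theory.
Import numFieldNormedType.Exports.

Local Open Scope classical_set_scope.
Local Open Scope ring_scope.

(* An interval with left endpoint 0 that contains 0, i.e. [0, b], [0, b[ or
   [0, +oo[ with 0 < b; the degenerate interval {0}, on which derivatives make
   no sense, is excluded by the last clause. *)
Definition interval_from0 (R : realType) (J : set R) : Prop :=
  [/\ is_interval J, J 0, (forall x, J x -> 0 <= x) & (exists2 x, J x & 0 < x)].

(* The limit is taken along J only, so derivatives are one-sided at the
   endpoints of J (in particular at 0), and the values of f outside J are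
   irrelevant. *)
Definition is_derive_in (R : realType) (V : normedModType R) (J : set R)
    (f : R -> V) (x : R) (l : V) : Prop :=
  (fun y : R => (y - x)^-1 *: (f y - f x)) @ within J x^' --> l.

(* On J, f is n times differentiable with n-th derivative g. *)
Fixpoint is_derive_n_in (R : realType) (V : normedModType R) (J : set R)
    (n : nat) (f g : R -> V) : Prop :=
  if n is m.+1 then
    exists2 f' : R -> V, (forall x, J x -> is_derive_in J f x (f' x))
                       & is_derive_n_in J m f' g
  else forall x, J x -> f x = g x.

(* Class C^k on J; continuity of the derivatives of order less than k is
   automatic. *)
Definition Ck_in (R : realType) (V : normedModType R) (J : set R) (k : nat)
    (f : R -> V) : Prop :=
  exists2 g : R -> V, is_derive_n_in J k f g & {within J, continuous g}.

(* f is j times differentiable on J, and c = f^(j)(0) / j! *)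
Definition is_taylor_coef (R : realType) (V : normedModType R) (J : set R)
    (f : R -> V) (j : nat) (c : V) : Prop :=
  exists2 g : R -> V, is_derive_n_in J j f g & c = (j`!%:R)^-1 *: g 0.

(* The library puts no real normed-space structure on R[i], so the real and
   imaginary parts are expanded separately. *)
Definition is_taylor_coefC (R : realType) (J : set R) (f : R -> R[i])
    (j : nat) (c : R[i]) : Prop :=
  is_taylor_coef J (fun x => complex.Re (f x) : R^o) j (complex.Re c) /\
  is_taylor_coef J (fun x => complex.Im (f x) : R^o) j (complex.Im c).

(* Indices 0, 1 : 'I_2 stand for the mathematical indices 1, 2. *)
Definition twist (R : realType) (D : 'M[R]_2) : R :=
  2^-1 * (D 0 1 - D 1 0).

Definition shear (R : realType) (D : 'M[R]_2) : R[i] :=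
  (2^-1 * (D 0 0 - D 1 1) +i* (2^-1 * (D 0 1 + D 1 0)))%C.

(* D'' = T D on J, D(0) = 0, D'(0) = I. *)
Definition jacobi_solution (R : realType) (J : set R) (T D : R -> 'M[R]_2)
    : Prop :=
  exists dD : R -> 'M[R]_2,
    [/\ forall x, J x -> is_derive_in J D x (dD x),
        forall x, J x -> is_derive_in J dD x (T x *m D x),
        D 0 = 0 & dD 0 = 1%:M].

(* Main.v *)
(* Write D = [[th + s, t + w], [t - w, th - s]], so that w is the twist and
   s + i t the shear. The symmetry of T makes the derivative of
   th w' - w th' - (t s' - s t') vanish, hence so do all its higher derivatives
   at 0. Expand the derivative of order m, 2 <= m < 2n, by the Leibniz rule at 0,
   where th = 0 and th' = 1. The shear contributes nothing: by its order of
   vanishing this is clear for m < 2n - 1, and for m = 2n - 1 the leading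
   coefficients of t s' and s t' cancel. If the derivatives of w of order less
   than m vanish, what remains is (m - 1) w^(m)(0) = 0. *)
Require Import Defs.
From HB Require Import structures.
From mathcomp Require Import all_boot all_order all_algebra.
From mathcomp Require Import all_classical all_reals all_analysis.
From mathcomp Require Import complex.
From mathcomp Require Import ring lra zify.

Import Order.TTheory GRing.Theory Num.Theory.
Import numFieldNormedType.Exports.

Local Open Scope classical_set_scope.
Local Open Scope ring_scope.

Set Implicit Arguments.
Unset Strict Implicit.

(** * Leibniz expansions and orders of vanishing *)

(* u and v stand for the successive derivatives of two functions at a point,
   and leibniz u v m for the m-th derivative of their product there. *)
Fixpoint leibniz {A : comPzRingType} (u v : nat -> A) (m : nat) : A :=
  if m is p.+1 then
    leibniz (fun i => u i.+1) v p + leibniz u (fun i => v i.+1) p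
  else u 0%N * v 0%N.

(** Every term of the expansion is a multiple of some [u i * v j] with [i + j = m], so [i < a] or
    [j < b]. *)
Lemma leibniz_eq0 {A : comPzRingType} (u v : nat -> A) a b m :
  (forall i, (i < a)%N -> u i = 0) -> (forall i, (i < b)%N -> v i = 0) ->
  (m < a + b)%N -> leibniz u v m = 0.
Proof.
elim: m u v a b => [|m IH] u v a b u0 v0 mab /=.
  by case: a u0 mab => [|a] u0 mab; [rewrite v0 ?mulr0|rewrite u0 ?mul0r].
rewrite (IH _ _ a.-1 b) ?(IH _ _ a b.-1) ?addr0//; try lia.
- by move=> i ib; apply: v0; lia.
- by move=> i ia; apply: u0; lia.
Qed.

(** Only the term [u a * v b] survives; the two recursive halves carry adjacent binomial
    coefficients, which Pascal's rule adds up. *)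
Lemma leibniz_lead {A : comPzRingType} (u v : nat -> A) a b :
  (forall i, (i < a)%N -> u i = 0) -> (forall i, (i < b)%N -> v i = 0) ->
  leibniz u v (a + b) = 'C(a + b, a)%:R * (u a * v b).
Proof.
elim: a b u v => [|a IHa] b u v u0 v0.
  elim: b v v0 => [|b IHb] v v0; first by rewrite bin0 mul1r.
  rewrite add0n /= (leibniz_eq0 (a := 0) (b := b.+1))// add0r.
  by rewrite -[b in leibniz _ _ b]add0n IHb ?bin0// => i ib; exact: v0.
elim: b v v0 => [|b IHb] v v0.
  rewrite addn0 /= [X in _ + X](leibniz_eq0 (a := a.+1) (b := 0)) ?addn0//.
  rewrite addr0 -[a in leibniz _ _ a]addn0 IHa ?addn0 ?binn// => i ia.
  exact: u0.
rewrite addSn /= IHa//; last by move=> i ia; exact: u0.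
rewrite -addSnnS IHb; last by move=> i ib; exact: v0.
by rewrite addSnnS binS natrD mulrDl addrC.
Qed.

(** * Derivatives along an interval *)

Section DeriveIn.
Context {R : realType} (J : set R).

(** [J] is convex and has a point [z] other than [x], and the segment from [x] to [z] meets every
    punctured neighbourhood of [x]. This makes limits along [J] unique. *)
Lemma within_dnbhs_proper (x : R) :
  interval_from0 J -> J x -> ProperFilter (within J x^').
Proof.
move=> [itvJ J0 Jge0 [b Jb b0]] Jx.
suff H : forall P, within J x^' P -> exists y, P y.
  by apply: Build_ProperFilter_ex => P /H.
move=> P; rewrite /within /= /dnbhs /within /=.
move=> /nbhs_ballP[e /= e0 He].
have [z Jz zx] : exists2 z, J z & z != x.
  have [->|] := eqVneq x 0; first by exists b => //; rewrite gt_eqF.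
  by rewrite eq_sym => ?; exists 0.
have nz0 : 0 < `|z - x| by rewrite normr_gt0 subr_eq0.
(* Chosen so that [0 < t < 1] and [t * |z - x| < e]. *)
pose t := e / (e + `|z - x|).
have d0 : 0 < e + `|z - x| by rewrite addr_gt0.
have t0 : 0 < t by rewrite divr_gt0.
have t1 : t < 1 by rewrite ltr_pdivrMr// mul1r ltrDl.
exists (x + t * (z - x)); apply: He.
- rewrite /ball /= opprD addrA subrr add0r normrN normrM gtr0_norm//.
  rewrite /t mulrAC ltr_pdivrMr// ltr_pM2l// ltrDr//.
- rewrite -subr_eq0 addrAC subrr add0r mulf_neq0 ?subr_eq0//.
  by rewrite gt_eqF.
- have [xz|zx'] := leP x z.
    by apply: (itvJ _ _ Jx Jz); apply/andP; split; nra.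
  by apply: (itvJ _ _ Jz Jx); apply/andP; split; nra.
Qed.

Lemma is_derive_in_unique (f : R -> R^o) x a b : interval_from0 J -> J x ->
  is_derive_in J f x a -> is_derive_in J f x b -> a = b.
Proof.
by move=> iJ Jx; apply: norm_cvg_unique; apply: fmap_proper_filter;
  exact: within_dnbhs_proper.
Qed.

Lemma eq_is_derive_in (V : normedModType R) (f g : R -> V) x l : J x ->
  (forall y, J y -> f y = g y) -> is_derive_in J f x l -> is_derive_in J g x l.
Proof.
move=> Jx fg; apply: cvg_trans; apply: near_eq_cvg.
rewrite near_withinE; apply: nearW => y Jy.
by rewrite !fg.
Qed.

Lemma is_derive_in_coord m n (A : R -> 'M[R]_(m.+1, n.+1)) x l i j :
  is_derive_in J A x l -> is_derive_in J (fun y => A y i j : R^o) x (l i j).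
Proof.
move=> dA.
apply: cvg_trans; last exact: (continuous_cvg _ (@coord_continuous R _ _ i j l) dA).
by apply: near_eq_cvg; apply: nearW => y /=; rewrite !mxE.
Qed.

Lemma is_derive_in_regularE (f : R -> R) x l :
  is_derive_in J (f : R -> R^o) x l =
  ((y - x)^-1 * (f y - f x) @[y --> within J x^'] --> l).
Proof. by []. Qed.

Lemma is_derive_inD (f g : R -> R) x a b :
  is_derive_in J (f : R -> R^o) x a -> is_derive_in J (g : R -> R^o) x b ->
  is_derive_in J (fun y => f y + g y : R^o) x (a + b).
Proof.
rewrite !is_derive_in_regularE => df dg.
apply: cvg_trans; last exact: cvgD df dg.
apply: near_eq_cvg; apply: nearW => y.
by rewrite [LHS]/= -mulrDr addrACA opprD.
Qed.

Lemma is_derive_in_cst (c x : R) : is_derive_in J (fun=> c : R^o) x 0.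
Proof.
rewrite is_derive_in_regularE subrr.
under eq_fun do rewrite mulr0.
exact: cvg_cst.
Qed.

Lemma is_derive_inM (f g : R -> R) x a b :
  is_derive_in J (f : R -> R^o) x a -> is_derive_in J (g : R -> R^o) x b ->
  is_derive_in J (fun y => f y * g y : R^o) x (a * g x + f x * b).
Proof.
rewrite !is_derive_in_regularE => df dg.
have cx : y - x @[y --> within J x^'] --> (0 : R).
  rewrite -(subrr x); apply: cvgB; last exact: cvg_cst.
  by apply: (@cvg_within_filter _ _ id); exact: nbhs_dnbhs.
(* Away from [x] this expression equals [g y], so continuity of [g] at [x] is drawn from its
   difference quotient. *)
have cg : g x + (y - x) * ((y - x)^-1 * (g y - g x)) @[y --> within J x^']
    --> g x.
  rewrite -[X in _ --> X]addr0 -[X in _ --> _ + X](mul0r b).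
  apply: cvgD; first exact: cvg_cst.
  exact: cvgM.
apply: cvg_trans; last first.
  exact: cvgD (cvgM df cg) (cvgM (cvg_cst (f x)) dg).
apply: near_eq_cvg; rewrite near_withinE.
near=> y => Jy.
have yx : y - x != 0.
  by rewrite subr_eq0; near: y; exact: nbhs_dnbhs_neq.
transitivity ((y - x)^-1 * (f y - f x) *
  (g x + (y - x) * ((y - x)^-1 * (g y - g x))) +
  f x * ((y - x)^-1 * (g y - g x))); first by [].
by field.
Unshelve. all: by end_near. Qed.


(** * Successive derivatives gathered in one sequence, so that [leibniz] applies pointwise *)

Definition deriv_seq N (F : nat -> R -> R) := forall i x, (i < N)%N -> J x ->
  is_derive_in J (F i : R -> R^o) x (F i.+1 x).

Lemma deriv_seq_le N M F : (M <= N)%N -> deriv_seq N F -> deriv_seq M F.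
Proof. by move=> MN dF i x iM; apply: dF; exact: leq_trans iM MN. Qed.

Lemma deriv_seq_shift N F :
  deriv_seq N.+1 F -> deriv_seq N (fun i => F i.+1).
Proof. by move=> dF i x iN; exact: dF. Qed.

Lemma deriv_seqD N F G : deriv_seq N F -> deriv_seq N G ->
  deriv_seq N (fun i x => F i x + G i x).
Proof. by move=> dF dG i x iN Jx; apply: is_derive_inD; [exact: dF|exact: dG]. Qed.

Lemma deriv_seqZ c N F : deriv_seq N F -> deriv_seq N (fun i x => c * F i x).
Proof.
move=> dF i x iN Jx.
have := is_derive_inM (is_derive_in_cst c x) (dF i x iN Jx).
by rewrite mul0r add0r.
Qed.

Lemma deriv_seqB N F G : deriv_seq N F -> deriv_seq N G ->
  deriv_seq N (fun i x => F i x - G i x).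
Proof.
move=> dF dG i x iN Jx; rewrite -mulN1r.
under eq_fun do rewrite -mulN1r.
by apply: is_derive_inD; [exact: dF|exact: (deriv_seqZ (c := -1) dG)].
Qed.

(** Each recursive call of [leibniz] shifts one factor and uses up one order of differentiability;
    hence the induction varies [N], [F] and [G]. *)
Lemma deriv_seq_leibniz N F G : deriv_seq N F -> deriv_seq N G ->
  deriv_seq N (fun i x => leibniz (F^~ x) (G^~ x) i).
Proof.
move=> dF dG i; elim: i N F G dF dG => [|i IH] [|N] F G dF dG x // iN Jx.
  by apply: is_derive_inM; [exact: dF|exact: dG].
apply: is_derive_inD.
  by apply: (IH N (fun i => F i.+1) G) => //;
    [exact: deriv_seq_shift|exact: deriv_seq_le dG].
by apply: (IH N F (fun i => G i.+1)) => //;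
  [exact: deriv_seq_le dF|exact: deriv_seq_shift].
Qed.

Lemma is_derive_n_in_deriv_seq N F m : deriv_seq N F -> (m <= N)%N ->
  is_derive_n_in J m (F 0%N : R -> R^o) (F m).
Proof.
elim: m N F => [//|m IH] [//|N] F dF mN.
exists (F 1%N : R -> R^o); first by move=> x; exact: dF.
exact: (IH N (fun i => F i.+1) (deriv_seq_shift dF)).
Qed.

Lemma deriv_seq_of_is_derive_n_in N (f g : R -> R) :
  is_derive_n_in J N (f : R -> R^o) (g : R -> R^o) ->
  exists F, deriv_seq N F /\ F 0%N = f.
Proof.
elim: N f => [|N IH] f /= => [_|[f' df /IH[F [dF F0]]]].
  by exists (fun=> f).
exists (fun i => if i is j.+1 then F j else f); split => //.
move=> [|i] x iN Jx; last exact: dF.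
by rewrite F0; exact: df.
Qed.

Hypothesis iJ : interval_from0 J.

Lemma deriv_seq_unique N F G : deriv_seq N F -> deriv_seq N G ->
  (forall x, J x -> F 0%N x = G 0%N x) ->
  forall m x, (m <= N)%N -> J x -> F m x = G m x.
Proof.
move=> dF dG FG0; elim=> [|m IH] x mN Jx; first exact: FG0.
apply: (is_derive_in_unique iJ Jx (dF m x mN Jx)).
apply: eq_is_derive_in (dG m x mN Jx) => // y Jy.
by rewrite IH// ltnW.
Qed.

(** The intermediate derivatives hidden in [is_derive_n_in] need not be those of [F], but
    derivatives along [J] are unique on [J]. *)
Lemma is_derive_n_in_deriv_seqE N F m g : deriv_seq N F -> (m <= N)%N ->
  is_derive_n_in J m (F 0%N : R -> R^o) (g : R -> R^o) ->
  forall x, J x -> F m x = g x.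
Proof.
elim: m N F => [//|m IH] [//|N] F dF mN [f' df f'g] x Jx.
apply: (IH N (fun i => F i.+1) (deriv_seq_shift dF) mN) => //.
(* [f'] and [F 1] are known to agree on [J] only: for order 0 this suffices, otherwise the next
   derivative of [f'] is carried over to [F 1]. *)
case: m {IH mN} f'g => [|m] /= f'g.
  move=> y Jy; rewrite -f'g//.
  exact: (is_derive_in_unique iJ Jy (dF 0%N y _ Jy) (df _ Jy)).
case: f'g => f'' d2f f''g; exists f'' => // y Jy.
apply: eq_is_derive_in (d2f y Jy) => // z Jz.
exact: (is_derive_in_unique iJ Jz (df _ Jz) (dF 0%N z _ Jz)).
Qed.

End DeriveIn.

(** * Matrix entries and the regularity of Jacobi solutions *)

Lemma mulmx2E (R : pzRingType) (A B : 'M[R]_2) i j :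
  (A *m B) i j = A i 0 * B 0 j + A i 1 * B 1 j.
Proof.
rewrite mxE big_ord_recr big_ord1 /=.
by congr (A i _ * B _ j + A i _ * B _ j); exact: val_inj.
Qed.

Lemma is_derive_n_in_coord (R : realType) (J : set R) N m n
    (A B : R -> 'M[R]_(m.+1, n.+1)) i j :
  is_derive_n_in J N A B ->
  is_derive_n_in J N (fun x => A x i j : R^o) (fun x => B x i j).
Proof.
elim: N A => [|N IH] A /=; first by move=> AB x Jx; rewrite AB.
move=> [A' dA A'B]; exists (fun x => A' x i j : R^o); last exact: IH.
by move=> x Jx; apply: is_derive_in_coord; exact: dA.
Qed.

(** Bootstrap: if the entries of [D] have [m <= k] derivatives, so have those of [T D] by the
    Leibniz rule, and [D'' = T D] gives [D] two more. *)
Lemma jacobi_solution_deriv_seq (R : realType) (J : set R) k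
    (T D : R -> 'M[R]_2) : Ck_in J k T -> jacobi_solution J T D ->
  forall i j, exists F, [/\ deriv_seq J k.+2 F, F 0%N = (fun x => D x i j),
    F 1%N 0 = (i == j)%:R & F 2%N = fun x => (T x *m D x) i j].
Proof.
move=> [Tk dT _] [dD [D1 D2 _ dD0]].
have Tseq i j := deriv_seq_of_is_derive_n_in (is_derive_n_in_coord i j dT).
have step m i j : (m <= k)%N ->
    (forall i j, exists F, deriv_seq J m F /\ F 0%N = fun x => D x i j) ->
  exists F, [/\ deriv_seq J m.+2 F, F 0%N = (fun x => D x i j),
    F 1%N = (fun x => dD x i j) & F 2%N = fun x => (T x *m D x) i j].
  move=> mk IH.
  have [A [dA A0]] := Tseq i 0; have [B [dB B0]] := Tseq i 1.
  have [F [dF F0]] := IH 0 j; have [G [dG G0]] := IH 1 j.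
  pose H p x := leibniz (A^~ x) (F^~ x) p + leibniz (B^~ x) (G^~ x) p.
  have dH : deriv_seq J m H.
    by apply: deriv_seqD; apply: deriv_seq_leibniz => //;
      exact: deriv_seq_le mk _.
  have H0 : H 0%N = fun x => (T x *m D x) i j.
    by apply/funext => x; rewrite mulmx2E /H /= A0 B0 F0 G0.
  exists (fun p => match p with
    | 0 => fun x => D x i j | 1 => fun x => dD x i j | q.+2 => H q end).
  split => //; move=> [|[|p]] x pm Jx; last exact: dH.
  - by apply: is_derive_in_coord; exact: D1.
  - by rewrite H0; apply: is_derive_in_coord; exact: D2.
(* The induction keeps one of the two orders gained, so it reaches [k] exactly; a last [step] then
   yields [k.+2]. *)
suff S m : (m <= k)%N ->
    forall i j, exists F, deriv_seq J m F /\ F 0%N = fun x => D x i j.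
  move=> i j; have [F [dF F0 F1 F2]] := step k i j (leqnn k) (S k (leqnn k)).
  by exists F; split => //; rewrite F1 dD0 mxE.
elim: m => [|m IH] mk i j; first by exists (fun _ x => D x i j).
have [F [dF F0 _ _]] := step m i j (ltnW mk) (IH (ltnW mk)).
by exists F; split => //; exact: deriv_seq_le dF.
Qed.

(* th, w, s, t are the components of D; E = D''. *)
Lemma twist_shear_wronskian (R : realType) (T D : 'M[R]_2) : T^T = T ->
  let E := T *m D in
  let th A := 2^-1 * (A 0 0 + A 1 1) in let w A := 2^-1 * (A 0 1 - A 1 0) in
  let s A := 2^-1 * (A 0 0 - A 1 1) in let t A := 2^-1 * (A 0 1 + A 1 0) in
  th D * w E - w D * th E - (t D * s E - s D * t E) = 0 :> R.
Proof.
move=> /matrixP/(_ 0 1); rewrite mxE => T10 /=.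
by rewrite !mulmx2E T10; field.
Qed.

(** * Vanishing of the Taylor coefficients of the twist *)

Theorem mainTheorem4 (R : realType) (n k : nat) (J : set R)
    (T D : R -> 'M[R]_2)
    (hn : (3 <= n)%N) (hk : (2 * n <= k)%N)
    (hJ : interval_from0 J)
    (hTsym : forall x, J x -> (T x)^T = T x)
    (hTCk : Ck_in J k T)
    (hD : jacobi_solution J T D)
    (hlow : forall j, (j < n)%N ->
       is_taylor_coefC J (fun e => shear (D e)) j 0)
    (hlead : exists2 c : R[i], c != 0 &
       is_taylor_coefC J (fun e => shear (D e)) n c) :
  forall j, (j < 2 * n)%N ->
    is_taylor_coef J (fun e => twist (D e) : R^o) j 0.
Proof.
have D0 : D 0 = 0 by case: hD => dD [].
have [itvJ J0 _ _] := hJ.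
have entry i j : exists F, [/\ deriv_seq J (2 * n).+2 F,
    F 0%N = (fun x => D x i j), F 1%N 0 = (i == j)%:R &
    F 2%N = fun x => (T x *m D x) i j].
  have [F [dF F0 F1 F2]] := jacobi_solution_deriv_seq hTCk hD i j.
  by exists F; split => //; exact: deriv_seq_le dF.
have [A [dA A0 A1 A2]] := entry 0 0; have [B [dB B0 B1 B2]] := entry 0 1.
have [C [dC C0 C1 C2]] := entry 1 0; have [E [dE E0 E1 E2]] := entry 1 1.
pose th i x := 2^-1 * (A i x + E i x); pose w i x := 2^-1 * (B i x - C i x).
pose s i x := 2^-1 * (A i x - E i x); pose t i x := 2^-1 * (B i x + C i x).
have dth : deriv_seq J (2 * n).+2 th by exact/deriv_seqZ/deriv_seqD.
have dw : deriv_seq J (2 * n).+2 w by exact/deriv_seqZ/deriv_seqB.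
have ds : deriv_seq J (2 * n).+2 s by exact/deriv_seqZ/deriv_seqB.
have dt : deriv_seq J (2 * n).+2 t by exact/deriv_seqZ/deriv_seqD.
have th0 : th 0%N 0 = 0 by rewrite /th A0 E0 D0 !mxE addr0 mulr0.
have th1 : th 1%N 0 = 1 by rewrite /th A1 E1 /=; field.
have w0 : w 0%N 0 = 0 by rewrite /w B0 C0 D0 !mxE subrr mulr0.
have w1 : w 1%N 0 = 0 by rewrite /w B1 C1 /=; field.
have fact_neq0 j : (j`!%:R)^-1 != 0 :> R.
  by rewrite invr_eq0 pnatr_eq0 -lt0n fact_gt0.
have coef0 F j : deriv_seq J (2 * n).+2 F -> (j < n)%N ->
    is_taylor_coef J (F 0%N : R -> R^o) j 0 -> F j 0 = 0.
  move=> dF jn [g Fg /esym/eqP].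
  rewrite scaler_eq0 (negbTE (fact_neq0 j)) /= => /eqP g0.
  by rewrite (is_derive_n_in_deriv_seqE hJ dF _ Fg J0) ?g0//; lia.
have sE : s 0%N = fun x => complex.Re (shear (D x)) by rewrite /s A0 E0.
have tE : t 0%N = fun x => complex.Im (shear (D x)) by rewrite /t B0 C0.
have wE : w 0%N = fun x => twist (D x) by rewrite /w B0 C0.
have s_low i : (i < n)%N -> s i 0 = 0.
  by move=> ni; apply: coef0 => //; rewrite sE; exact: (hlow i ni).1.
have t_low i : (i < n)%N -> t i 0 = 0.
  by move=> ni; apply: coef0 => //; rewrite tE; exact: (hlow i ni).2.
(* [L F G] lists the derivatives of [F G'], so [W] lists those of the difference of Wronskians. *)
pose L (F G : nat -> R -> R) i x :=
  leibniz (F^~ x) (fun p => G p.+1 x) i.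
have dL F G : deriv_seq J (2 * n).+2 F -> deriv_seq J (2 * n).+2 G ->
    deriv_seq J (2 * n).+1 (L F G).
  move=> dF dG; apply: (deriv_seq_leibniz (G := fun i => G i.+1)).
    exact: deriv_seq_le dF.
  exact: deriv_seq_shift.
pose W i x := L th w i x - L w th i x - (L t s i x - L s t i x).
have dW : deriv_seq J (2 * n).+1 W.
  by apply: deriv_seqB; apply: deriv_seqB; exact: dL.
(* The products of first derivatives cancel, and the second derivatives are entries of [T D]. *)
have W1 x : J x -> W 1%N x = 0.
  move=> Jx; have := twist_shear_wronskian (D x) (hTsym x Jx).
  rewrite /= => <-; rewrite /W /L /= /th /w /t /s A0 B0 C0 E0 A2 B2 C2 E2.
  by ring.
have WS m : (m < 2 * n)%N -> W m.+1 0 = 0.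
  move=> mn; have dz : deriv_seq J (2 * n) (fun _ _ => 0 : R).
    by move=> i x _ _; exact: is_derive_in_cst.
  exact: (deriv_seq_unique hJ (deriv_seq_shift dW) dz W1 (ltnW mn) J0).
have shear_part m : (m < 2 * n)%N -> L t s m 0 = L s t m 0.
  move=> m2n; have n0 : (0 < n)%N by lia.
  (* Differentiation lowers the order of vanishing by one, so only the order [n + n.-1], the last
     one below [2 * n], needs the leading terms. *)
  have s_low' i : (i < n.-1)%N -> s i.+1 0 = 0 by move=> ?; apply: s_low; lia.
  have t_low' i : (i < n.-1)%N -> t i.+1 0 = 0 by move=> ?; apply: t_low; lia.
  have [mn|mn] := ltnP m (n + n.-1).
    by rewrite /L !(leibniz_eq0 (a := n) (b := n.-1)).
  (* Both sides are the same binomial coefficient times [s n 0 * t n 0]. *)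
  have -> : m = (n + n.-1)%N by lia.
  by rewrite /L !leibniz_lead// prednK// (mulrC (s n 0)).
have w_low m : (m < 2 * n)%N -> w m 0 = 0.
  elim/ltn_ind: m => -[//|[//|m]] IH mn.
  have Wm := WS m.+1 (ltnW mn).
  move: Wm; rewrite /W shear_part// subrr subr0.
  (* [th] vanishes to order 1 and [w'] to order [m.+1]; the binomial coefficient is [m.+2] over
     1. *)
  have -> : L th w m.+2 0 = m.+2%:R * w m.+2 0.
    rewrite /L -[m.+2]add1n leibniz_lead ?bin1 ?th1 ?mul1r//.
      by move=> [].
    by move=> i im; apply: IH; lia.
  (* Here [w] vanishes to order [m.+2] and [th'] starts with 1. *)
  have -> : L w th m.+2 0 = w m.+2 0.
    rewrite /L -[m.+2 in LHS]addn0 leibniz_lead ?addn0 ?binn ?th1 ?mulr1 ?mul1r//.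
    by move=> i im; apply: IH => //; lia.
  (* The difference is [m.+1] times [w m.+2 0], and [m.+1] is nonzero in [R]. *)
  rewrite -natr1 mulrDl mul1r addrK => /eqP.
  by rewrite mulf_eq0 pnatr_eq0 => /eqP.
move=> j jn; exists (w j : R -> R^o); last by rewrite w_low// scaler0.
by rewrite -wE; apply: is_derive_n_in_deriv_seq dw _; lia.
Qed.
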